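(* Let $L_2$ be the $3$-dimensional complex Lie algebra with basis $z_1,z_2,z_3$ and nonzero brackets $[z_3,z_1]=z_1$, $[z_3,z_2]=z_2$. There is a unique subalgebra of $\mathfrak{so}(4,\mathbb{C})$ isomorphic to $L_2$, up to inner automorphism, given by $$L_2^1=\langle x_1,\ x_2,\ h_1+h_2\rangle.$$
   Context: $\mathfrak{so}(4,\mathbb{C})\cong\mathfrak{sl}(2,\mathbb{C})\oplus\mathfrak{sl}(2,\mathbb{C})$ is realized as the Lie algebra of $4\times4$ complex block diagonal matrices with two traceless $2\times 2$ diagonal blocks. With $E_{ij}$ the $4\times 4$ matrix units, its Chevalley basis is $x_1=E_{12}$, $y_1=E_{21}$, $h_1=E_{11}-E_{22}$, $x_2=E_{34}$, $y_2=E_{43}$, $h_2=E_{33}-E_{44}$. The notation $\langle\cdots\rangle$ denotes complex linear span. The inner automorphisms of $\mathfrak{so}(4,\mathbb{C})$ are the maps $X\mapsto AXA^{-1}$ with $A\in SL(2,\mathbb{C})\times SL(2,\mathbb{C})$ (block diagonal $4\times4$ matrices with both $2\times2$ blocks of determinant $1$). Two subalgebras $S,S'$ are equivalent (up to inner automorphism), written $S\sim S'$, if $\psi(S)=S'$ for some inner automorphism $\psi$ of $\mathfrak{so}(4,\mathbb{C})$. Brackets of basis elements not listed and not determined by antisymmetry are zero. *)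

(* Defs.v *)
From HB Require Import structures.
From mathcomp Require Import all_boot all_order all_algebra ring.
From mathcomp Require Export reals complex.

Set Implicit Arguments.
Unset Strict Implicit.
Unset Printing Implicit Defensive.

Import GRing.Theory.
Local Open Scope ring_scope.

Record lieAlg (K : fieldType) := LieAlg {
  lie_sort :> vectType K;
  lie : lie_sort -> lie_sort -> lie_sort;
  lie_linearl : forall v a x y, lie (a *: x + y) v = a *: lie x v + lie y v;
  lie_linearr : forall v a x y, lie v (a *: x + y) = a *: lie v x + lie v y;
  lie_alt : forall x, lie x x = 0;
  lie_jacobi : forall x y z,
    lie x (lie y z) + lie y (lie z x) + lie z (lie x y) = 0 }.

Definition lie_isomorphic (K : fieldType) (L M : lieAlg K) : Prop :=
  exists f : 'Hom(L, M),
    bijective f /\ forall x y : L, f (lie x y) = lie (f x) (f y).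

Record lieSubalg (K : fieldType) (L : lieAlg K) := LieSubalg {
  lsub_space :> {vspace L};
  lsub_closed : {in lsub_space &, forall x y, lie x y \in lsub_space} }.

Section SubLie.
Variables (K : fieldType) (L : lieAlg K) (S : lieSubalg L).

Definition sub_lie (u v : subvs_of S) : subvs_of S :=
  vsproj S (lie (vsval u) (vsval v)).

Lemma vsval_sub_lie u v : vsval (sub_lie u v) = lie (vsval u) (vsval v).
Proof. by rewrite vsprojK // lsub_closed ?subvsP. Qed.

Lemma sub_lie_linearl v a x y :
  sub_lie (a *: x + y) v = a *: sub_lie x v + sub_lie y v.
Proof.
by apply: subvs_inj; rewrite linearP /= !vsval_sub_lie linearP lie_linearl.
Qed.

Lemma sub_lie_linearr v a x y :
  sub_lie v (a *: x + y) = a *: sub_lie v x + sub_lie v y.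
Proof.
by apply: subvs_inj; rewrite linearP /= !vsval_sub_lie linearP lie_linearr.
Qed.

Lemma sub_lie_alt x : sub_lie x x = 0.
Proof. by apply: subvs_inj; rewrite vsval_sub_lie lie_alt linear0. Qed.

Lemma sub_lie_jacobi x y z :
  sub_lie x (sub_lie y z) + sub_lie y (sub_lie z x)
    + sub_lie z (sub_lie x y) = 0.
Proof.
by apply: subvs_inj; rewrite !linearD linear0 /= !vsval_sub_lie lie_jacobi.
Qed.

Definition subLieAlg : lieAlg K :=
  LieAlg sub_lie_linearl sub_lie_linearr sub_lie_alt sub_lie_jacobi.

End SubLie.

Section GeneralLinear.
Variables (K : fieldType) (n : nat).
Implicit Types X Y Z : 'M[K]_n.

Definition mx_lie X Y := X *m Y - Y *m X.

Lemma mx_lie_linearl Z a X Y :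
  mx_lie (a *: X + Y) Z = a *: mx_lie X Z + mx_lie Y Z.
Proof.
rewrite /mx_lie mulmxDl mulmxDr -scalemxAl -scalemxAr scalerBr.
by rewrite opprD addrACA.
Qed.

Lemma mx_lie_linearr Z a X Y :
  mx_lie Z (a *: X + Y) = a *: mx_lie Z X + mx_lie Z Y.
Proof.
rewrite /mx_lie mulmxDl mulmxDr -scalemxAl -scalemxAr scalerBr.
by rewrite opprD addrACA.
Qed.

Lemma mx_lie_alt X : mx_lie X X = 0.
Proof. exact: subrr. Qed.

Lemma mx_lie_jacobi X Y Z :
  mx_lie X (mx_lie Y Z) + mx_lie Y (mx_lie Z X) + mx_lie Z (mx_lie X Y) = 0.
Proof.
rewrite /mx_lie !mulmxBl !mulmxBr !mulmxA.
by apply/matrixP => i j; rewrite !mxE; ring.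
Qed.

Definition gl : lieAlg K :=
  LieAlg mx_lie_linearl mx_lie_linearr mx_lie_alt mx_lie_jacobi.

End GeneralLinear.

Section So4.
Variable K : fieldType.

(* The type 'M_4 is convertible to 'M_(2 + 2), which gives the 2 x 2 blocks. *)
Definition so4_eqns (X : 'M[K]_(2 + 2)) : 'M[K]_2 * 'M[K]_2 * (K^o * K^o) :=
  (ursubmx X, dlsubmx X, (\tr (ulsubmx X), \tr (drsubmx X))).

Lemma so4_eqns_is_linear : linear so4_eqns.
Proof.
move=> a X Y; rewrite /so4_eqns /ursubmx /dlsubmx /ulsubmx /drsubmx.
by rewrite !linearP.
Qed.

HB.instance Definition _ :=
  GRing.isLinear.Build K 'M[K]_(2 + 2) ('M[K]_2 * 'M[K]_2 * (K^o * K^o))%type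
    *:%R so4_eqns so4_eqns_is_linear.

Definition so4_space : {vspace 'M[K]_4} := lker (linfun so4_eqns).

Lemma so4P (X : 'M[K]_(2 + 2)) :
  reflect (exists X1 X2 : 'M[K]_2,
             [/\ \tr X1 = 0, \tr X2 = 0 & X = block_mx X1 0 0 X2])
          ((X : 'M[K]_4) \in so4_space).
Proof.
rewrite /so4_space memv_ker lfunE /= /so4_eqns.
apply: (iffP eqP) => [[Xur Xdl tr1 tr2]|].
  exists (ulsubmx X), (drsubmx X); split => //.
  by rewrite -{1}[X]submxK Xur Xdl.
case=> X1 [X2 [tr1 tr2 ->]].
by rewrite block_mxKur block_mxKdl block_mxKul block_mxKdr tr1 tr2.
Qed.

Lemma so4_closed :
  {in so4_space &, forall x y : gl K 4, lie x y \in so4_space}.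
Proof.
move=> X Y /so4P[X1 [X2 [_ _ ->]]] /so4P[Y1 [Y2 [_ _ ->]]].
apply/so4P; exists (mx_lie X1 Y1), (mx_lie X2 Y2).
rewrite /= /mx_lie !linearB /= ![\tr (Y1 *m _)]mxtrace_mulC.
rewrite ![\tr (Y2 *m _)]mxtrace_mulC !subrr; split => //.
rewrite -[4%N]/(2 + 2)%N !mulmx_block.
by rewrite !mulmx0 !mul0mx !addr0 !add0r opp_block_mx add_block_mx !subr0.
Qed.

Definition so4 : lieSubalg (gl K 4) :=
  @LieSubalg K (gl K 4) so4_space so4_closed.

(* Matrix units with 1-based indices, as in E_{12}. *)
Definition E (i j : nat) : 'M[K]_4 := delta_mx (inord i.-1) (inord j.-1).

Definition x1 := E 1 2.
Definition y1 := E 2 1.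
Definition h1 := E 1 1 - E 2 2.
Definition x2 := E 3 4.
Definition y2 := E 4 3.
Definition h2 := E 3 3 - E 4 4.

Definition inner_aut (A : 'M[K]_4) : 'End('M[K]_4) :=
  linfun (mulmxr (invmx A) \o mulmx A).

Lemma inner_autE A X : inner_aut A X = A *m X *m invmx A.
Proof. by rewrite lfunE. Qed.

Definition inner_equiv (S S' : {vspace 'M[K]_4}) : Prop :=
  exists A1 A2 : 'M[K]_2,
    [/\ \det A1 = 1, \det A2 = 1
      & (inner_aut (block_mx A1 0 0 A2) @: S)%VS = S'].

End So4.

Section L2.
Variable K : fieldType.
Implicit Types u v w : 'rV[K]_3.

Definition z (i : nat) : 'rV[K]_3 := delta_mx 0 (inord i.-1).

Local Notation "u ^[ i ]" := (u 0 (inord i.-1)) (at level 2, format "u ^[ i ]").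

(* The bilinear alternating extension of [z3, z1] = z1, [z3, z2] = z2,
   [z1, z2] = 0. *)
Definition L2_lie u v : 'rV[K]_3 :=
  (u^[3] * v^[1] - u^[1] * v^[3]) *: z 1
  + (u^[3] * v^[2] - u^[2] * v^[3]) *: z 2.

Lemma L2_lie_linearl w a u v :
  L2_lie (a *: u + v) w = a *: L2_lie u w + L2_lie v w.
Proof. by apply/rowP => j; rewrite !mxE; ring. Qed.

Lemma L2_lie_linearr w a u v :
  L2_lie w (a *: u + v) = a *: L2_lie w u + L2_lie w v.
Proof. by apply/rowP => j; rewrite !mxE; ring. Qed.

Lemma L2_lie_alt u : L2_lie u u = 0.
Proof. by apply/rowP => j; rewrite !mxE; ring. Qed.

Lemma L2_lie_jacobi u v w :
  L2_lie u (L2_lie v w) + L2_lie v (L2_lie w u) + L2_lie w (L2_lie u v) = 0.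
Proof.
apply/rowP => j; rewrite !mxE /=.
by rewrite -!val_eqE /= !inordK //=; ring.
Qed.

Definition L2 : lieAlg K :=
  LieAlg L2_lie_linearl L2_lie_linearr L2_lie_alt L2_lie_jacobi.

Lemma L2_z3z1 : lie (z 3 : L2) (z 1) = z 1.
Proof.
apply/rowP => j; rewrite !mxE /=.
by rewrite -!val_eqE /= !inordK //=; ring.
Qed.

Lemma L2_z3z2 : lie (z 3 : L2) (z 2) = z 2.
Proof.
apply/rowP => j; rewrite !mxE /=.
by rewrite -!val_eqE /= !inordK //=; ring.
Qed.

Lemma L2_z1z2 : lie (z 1 : L2) (z 2) = 0.
Proof.
apply/rowP => j; rewrite !mxE /=.
by rewrite -!val_eqE /= !inordK //=; ring.
Qed.

Lemma L2_basis : basis_of {: L2} [:: z 1; z 2; z 3].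
Proof.
rewrite basisEdim size_tuple dimvf /dim /= andbT.
apply/subvP => v _.
have -> : v = v^[1] *: z 1 + v^[2] *: z 2 + v^[3] *: z 3.
  apply/rowP => j; rewrite !mxE -!val_eqE /= !inordK //.
  case: j => [[|[|[|//]]]] jP /=; rewrite ?mulr0 ?mulr1 ?addr0 ?add0r;
    by congr (v _ _); apply/val_inj; rewrite /= inordK.
by rewrite !memvD // memvZ // memv_span // !inE eqxx ?orbT.
Qed.

End L2.

(* Main.v *)
(* If z1, z2, z3 are mapped to (a1, a2), (b1, b2), (c1, c2), then a_i and b_i
   are eigenvectors of ad c_i on sl(2) for the eigenvalue 1.  When this
   eigenspace is nonzero it is a line spanned by a nilpotent matrix, and a
   conjugation with determinant 1 moves the line to that of x_i and c_i into
   h_i / 2 + <x_i>.  As (a1, a2) and (b1, b2) are linearly independent, the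
   eigenspace is nonzero in both factors.  So one inner automorphism sends the
   whole subalgebra into <x1, x2, h1 + h2>, and the dimensions agree. *)
Require Import Defs.
From mathcomp Require Import all_boot all_order all_algebra.
From HB Require Import structures.
From mathcomp Require Import ring.
Import GRing.Theory Num.Theory.
Local Open Scope ring_scope.

Set Implicit Arguments.
Unset Strict Implicit.
Unset Printing Implicit Defensive.

(** * Subalgebras as images of injective Lie homomorphisms *)

Section Embedding.
Variables (K : fieldType) (L M : lieAlg K).

Definition lie_embedding (e : 'Hom(M, L)) : Prop :=
  lker e = 0%VS /\ forall x y : M, e (lie x y) = lie (e x) (e y).

(** Trades the type [subvs_of S] for a linear map into the ambient algebra. One direction composes
    the inverse isomorphism with the inclusion of [S]; the other inverts [e] on its image. *)
Lemma lie_isomorphic_embedding (S : lieSubalg L) :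
  lie_isomorphic (subLieAlg S) M <->
  exists2 e : 'Hom(M, L), lie_embedding e & limg e = S.
Proof.
split=> [[f [[g fK gK] f_lie]]|[e [e_inj e_lie] eS]].
  have ker_f : lker f == 0%VS.
    by apply/lker0P => x y; exact: (can_inj fK).
  have f_invE x : (f^-1)%VF x = g x.
    by rewrite -{1}[x]gK lker0_lfunK.
  exists (linfun (@vsval K L S : subLieAlg S -> L) \o f^-1)%VF; first split.
  - apply/eqP/lker0P => x y; rewrite !comp_lfunE !lfunE /= !f_invE.
    by move/subvs_inj/(can_inj gK).
  - move=> x y; rewrite !comp_lfunE !lfunE /= !f_invE -vsval_sub_lie.
    by congr vsval; apply: (can_inj fK); rewrite f_lie !gK.
  apply/vspaceP => v; apply/memv_imgP/idP => [[x _ ->]|vS].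
    by rewrite comp_lfunE lfunE /= subvsP.
  exists (f (vsproj S v)); first exact: memvf.
  by rewrite comp_lfunE lfunE /= f_invE fK vsprojK.
move/eqP: e_inj => e_inj.
have eP x : e x \in (S : {vspace L}) by rewrite -eS memv_img ?memvf.
have SP (u : subvs_of S) : vsval u \in limg e by rewrite eS subvsP.
exists (e^-1 \o linfun (@vsval K L S : subLieAlg S -> L))%VF; split.
  exists (fun x => vsproj S (e x)) => x.
    rewrite comp_lfunE lfunE /=; apply: subvs_inj.
    by rewrite vsprojK ?eP // limg_lfunVK ?SP.
  by rewrite comp_lfunE lfunE /= vsprojK ?eP // lker0_lfunK.
move=> x y; rewrite !comp_lfunE !lfunE /= vsval_sub_lie.
by apply: (lker0P e_inj); rewrite e_lie !limg_lfunVK ?SP // -vsval_sub_lie SP.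
Qed.

Lemma limg_lie_closed (e : 'Hom(M, L)) :
  lie_embedding e -> {in limg e &, forall x y, lie x y \in limg e}.
Proof.
case=> _ e_lie _ _ /memv_imgP[x _ ->] /memv_imgP[y _ ->].
by rewrite -e_lie memv_img ?memvf.
Qed.

End Embedding.

(** * Conjugation of 2 x 2 matrices and eigenvectors of [ad C] for the eigenvalue 1 *)

Section Sl2.
Variable K : fieldType.
Implicit Types A C M N X Y : 'M[K]_2.

Definition mx2 (a b c d : K) : 'M[K]_2 :=
  \matrix_(i, j) if i == 0 then if j == 0 then a else b
                 else if j == 0 then c else d.

Lemma mx2_eta X : X = mx2 (X 0 0) (X 0 1) (X 1 0) (X 1 1).
Proof.
have ord2 (i : 'I_2) : i = if i == 0 then 0 else 1.
  by apply/val_inj; case: i => [[|[|]]].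
by apply/matrixP => i j; rewrite mxE (ord2 i) (ord2 j); do 2!case: ifP.
Qed.

Lemma mx2_inj a b c d a' b' c' d' :
  mx2 a b c d = mx2 a' b' c' d' -> [/\ a = a', b = b', c = c' & d = d'].
Proof.
move/matrixP=> e; have := (e 0 0, e 0 1, e 1 0, e 1 1).
by rewrite !mxE => -[[[]]].
Qed.

Lemma add_mx2 a b c d a' b' c' d' :
  mx2 a b c d + mx2 a' b' c' d' = mx2 (a + a') (b + b') (c + c') (d + d').
Proof. by apply/matrixP => i j; rewrite !mxE; do 2!case: ifP. Qed.

Lemma scale_mx2 k a b c d :
  k *: mx2 a b c d = mx2 (k * a) (k * b) (k * c) (k * d).
Proof. by apply/matrixP => i j; rewrite !mxE; do 2!case: ifP. Qed.

Lemma mul_mx2 a b c d a' b' c' d' :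
  mx2 a b c d *m mx2 a' b' c' d' =
  mx2 (a * a' + b * c') (a * b' + b * d') (c * a' + d * c') (c * b' + d * d').
Proof.
apply/matrixP => i j; rewrite !mxE !big_ord_recl big_ord0 !mxE /=.
by do 2!case: ifP => _; rewrite addr0.
Qed.

Lemma det_mx2 a b c d : \det (mx2 a b c d) = a * d - b * c.
Proof.
rewrite (expand_det_row _ 0) !big_ord_recl big_ord0 /cofactor.
by rewrite !det_mx11 !mxE /=; ring.
Qed.

Lemma tr_mx2 a b c d : \tr (mx2 a b c d) = a + d.
Proof. by rewrite /mxtrace !big_ord_recl big_ord0 !mxE addr0. Qed.

Lemma mx2_0 : 0 = mx2 0 0 0 0.
Proof. by apply/matrixP => i j; rewrite !mxE; do 2!case: ifP. Qed.

Lemma lie_mx2 a b c d a' b' c' d' :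
  mx_lie (mx2 a b c d) (mx2 a' b' c' d') =
  mx2 (b * c' - c * b') (a * b' + b * d' - a' * b - b' * d)
      (c * a' + d * c' - c' * a - d' * c) (c * b' - b * c').
Proof.
rewrite /mx_lie !mul_mx2 -scaleN1r scale_mx2 add_mx2.
by congr mx2; ring.
Qed.

Definition conj_mx n (A X : 'M[K]_n) : 'M[K]_n := A *m X *m invmx A.

Lemma conj_mxD n (A X Y : 'M[K]_n) :
  conj_mx A (X + Y) = conj_mx A X + conj_mx A Y.
Proof. by rewrite /conj_mx mulmxDr mulmxDl. Qed.

Lemma conj_mxZ n (A X : 'M[K]_n) k : conj_mx A (k *: X) = k *: conj_mx A X.
Proof. by rewrite /conj_mx -scalemxAr -scalemxAl. Qed.

Lemma conj_mx_inj n (A : 'M[K]_n) : A \in unitmx -> injective (conj_mx A).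
Proof.
by move=> uA X Y /(can_inj (mulmxKV uA)) /(can_inj (mulKmx uA)).
Qed.

Lemma lie_conj_mx n (A X Y : 'M[K]_n) : A \in unitmx ->
  mx_lie (conj_mx A X) (conj_mx A Y) = conj_mx A (mx_lie X Y).
Proof.
move=> uA; rewrite /mx_lie /conj_mx mulmxBr mulmxBl.
by rewrite !mulmxA !(mulmxKV uA).
Qed.

Lemma tr_conj_mx n (A X : 'M[K]_n) : A \in unitmx -> \tr (conj_mx A X) = \tr X.
Proof. by move=> uA; rewrite mxtrace_mulC mulmxA mulVmx // mul1mx. Qed.

(** The element [c h + t x] of the standard Borel subalgebra of sl(2); [borel 0 t] runs over the
    line of [x]. *)
Definition borel (c t : K) : 'M[K]_2 := mx2 c t 0 (- c).

Lemma lie_borel c t c' t' :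
  mx_lie (borel c t) (borel c' t') = borel 0 (2 * (c * t' - c' * t)).
Proof. by rewrite /borel lie_mx2; congr mx2; ring. Qed.

Lemma borel_linear k c t c' t' :
  borel (k * c + c') (k * t + t') = k *: borel c t + borel c' t'.
Proof. by rewrite /borel scale_mx2 add_mx2; congr mx2; ring. Qed.

Lemma conj_borel_neq0 A N t :
  A \in unitmx -> N != 0 -> conj_mx A N = borel 0 t -> t != 0.
Proof.
move=> uA N0 eN; apply: contraNneq N0 => t0; apply/eqP/(conj_mx_inj uA).
by rewrite eN t0 /borel oppr0 -mx2_0 /conj_mx mulmx0 mul0mx.
Qed.

(** If the second row of [A] lies in the left kernel of [N], then the second row of the conjugate
    vanishes, and trace zero kills the remaining diagonal entry. *)
Lemma nilpotent_conj_borel N : \tr N = 0 -> \det N = 0 ->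
  exists2 A, \det A = 1 & exists t, conj_mx A N = borel 0 t.
Proof.
rewrite [N]mx2_eta; move: (N 0 0) (N 0 1) (N 1 0) (N 1 1) => a b c d.
rewrite tr_mx2 det_mx2 => trN detN.
have da : d = - a by apply/eqP; rewrite -addr_eq0 addrC trN.
(* Moving [A] to the right avoids computing its inverse. *)
suff [A detA [t AN]] : exists2 A, \det A = 1 &
    exists t, A *m mx2 a b c d = borel 0 t *m A.
  exists A => //; exists t; rewrite /conj_mx AN mulmxK //.
  by rewrite unitmxE detA unitr1.
move: detN; rewrite da /borel; have [->|c0] := eqVneq c 0 => detN.
  have a0 : a = 0.
    by apply/eqP; rewrite -sqrf_eq0 -oppr_eq0 -detN; apply/eqP; ring.
  exists (mx2 1 0 0 1); first by rewrite det_mx2; ring.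
  by exists b; rewrite !mul_mx2 a0; congr mx2; ring.
(* The second row [(c, -a)] spans the left kernel of N. *)
exists (mx2 0 (- c^-1) c (- a)); first by rewrite det_mx2; field.
(* The first row of [A] times [N] is [- c^-1] times the second row of [A]. *)
exists (- c^-1); rewrite !mul_mx2; congr mx2; try by field.
by transitivity (- (a * - a - b * c)); [ring | rewrite detN; ring].
Qed.

Hypothesis two_neq0 : 2 != 0 :> K.

Lemma sl2_eigenvector_nilpotent C N : \tr C = 0 -> mx_lie C N = N ->
  \tr N = 0 /\ \det N = 0.
Proof.
rewrite [C]mx2_eta [N]mx2_eta.
move: (C 0 0) (C 0 1) (C 1 0) (C 1 1) => p q r s.
move: (N 0 0) (N 0 1) (N 1 0) (N 1 1) => a b c d.
rewrite !tr_mx2 det_mx2 lie_mx2 => trC /mx2_inj[ea eb ec ed].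
have sp : s = - p by apply/eqP; rewrite -addr_eq0 addrC trC.
have trN : a + d = 0 by rewrite -ea -ed; ring.
have da : d = - a by apply/eqP; rewrite -addr_eq0 addrC trN.
(* [2 det N = - tr (N^2) = - tr ([C, N] N) = 0], written out in coordinates. *)
split=> //; apply: (mulfI two_neq0); rewrite mulr0.
transitivity ((q * c - r * b - a) * (2 * a)
  + (p * b + q * d - a * q - b * s - b) * c
  + (r * a + s * c - c * p - d * r - c) * b).
  by rewrite da sp; ring.
by rewrite ea eb ec !subrr; ring.
Qed.

(** Once [N] is a nonzero multiple of [x], the eigenvector equation determines [C] up to its [x]
    component, and this form of [C] forces every other eigenvector onto the line of [x]. A single
    [A] serves all [M], since two eigenvectors are later conjugated together. *)
Lemma sl2_eigenvector_conj C N :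
    \tr C = 0 -> mx_lie C N = N -> N != 0 ->
  exists2 A, \det A = 1 &
    (exists s, conj_mx A C = borel 2^-1 s) /\
    forall M, mx_lie C M = M -> exists t, conj_mx A M = borel 0 t.
Proof.
move=> trC eCN N0.
have [trN detN] := sl2_eigenvector_nilpotent trC eCN.
have [A detA [t eN]] := nilpotent_conj_borel trN detN.
have uA : A \in unitmx by rewrite unitmxE detA unitr1.
exists A => //.
have t0 := conj_borel_neq0 uA N0 eN.
have [s eC] : exists s, conj_mx A C = borel 2^-1 s.
  have := lie_conj_mx C N uA; have := tr_conj_mx C uA; rewrite eCN eN trC.
  rewrite [conj_mx A C]mx2_eta.
  move: (_ 0 0) (_ 0 1) (_ 1 0) (_ 1 1) => p q r s.
  rewrite tr_mx2 => trC'; have sp : s = - p.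
    by apply/eqP; rewrite -addr_eq0 addrC trC'.
  (* The upper entries of the conjugated equation read [- r t = 0] and [2 p t = t]. *)
  rewrite /borel lie_mx2 sp => /mx2_inj[er ep _ _]; exists q.
  have -> : r = 0.
    apply: (mulIf t0); rewrite mul0r; apply/eqP; rewrite -oppr_eq0 -er.
    by apply/eqP; ring.
  have -> // : p = 2^-1.
  apply: (mulIf t0); apply: (mulfI two_neq0); rewrite mulVKf // -[RHS]ep.
  by ring.
split=> [|M eCM]; first by exists s.
have := lie_conj_mx C M uA; rewrite eCM eC [conj_mx A M]mx2_eta.
move: (_ 0 0) (_ 0 1) (_ 1 0) (_ 1 1) => a b c d.
(* The lower left entry reads [- c = c], and the diagonal entries [a = s c] and [d = - s c]. *)
rewrite /borel lie_mx2 => /mx2_inj[ea _ ec ed]; exists b.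
have c0 : c = 0.
  apply: (mulfI two_neq0); rewrite mulr0; transitivity (c + c); first by ring.
  by rewrite -{2}ec; field.
by congr mx2 => //; rewrite -?ea -?ed c0; ring.
Qed.

(** A conjugation that sends [N], if nonzero, to a multiple of [x] does the same to [M], so the
    eigenspace is at most a line. *)
Lemma sl2_eigenvectors_dependent C N M :
    \tr C = 0 -> mx_lie C N = N -> mx_lie C M = M ->
  exists s t, s *: N + t *: M = 0 /\ (s, t) != 0.
Proof.
move=> trC eN eM; have [N0|N0] := eqVneq N 0.
  by exists 1, 0; rewrite N0 scaler0 scale0r addr0 xpair_eqE oner_eq0.
have [A detA [_ eig]] := sl2_eigenvector_conj trC eN N0.
have uA : A \in unitmx by rewrite unitmxE detA unitr1.
have [[t Nt] [u Mu]] := (eig _ eN, eig _ eM).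
have t0 := conj_borel_neq0 uA N0 Nt.
exists (- u), t; rewrite xpair_eqE negb_and t0 orbT; split=> //.
apply: (conj_mx_inj uA); rewrite conj_mxD !conj_mxZ Nt Mu.
rewrite [RHS]/conj_mx mulmx0 mul0mx mx2_0 /borel !scale_mx2 add_mx2.
by congr mx2; ring.
Qed.

End Sl2.

(** * Block diagonal matrices and their inner automorphisms *)

Section So4.
Variable K : fieldType.
Implicit Types X Y : 'M[K]_2.

(** Typed over ['M[K]_4], so the size 4 is refolded to [2 + 2] before block lemmas apply. *)
Definition diag2 X Y : 'M[K]_4 := block_mx X 0 0 Y.

Lemma diag2_inj X Y X' Y' : diag2 X Y = diag2 X' Y' -> X = X' /\ Y = Y'.
Proof. by case/(@eq_block_mx K 2 2 2 2). Qed.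

Lemma diag2_linear k X Y X' Y' :
  diag2 (k *: X + X') (k *: Y + Y') = k *: diag2 X Y + diag2 X' Y'.
Proof.
by rewrite /diag2 -[4%N]/(2 + 2)%N scale_block_mx add_block_mx !scaler0 !addr0.
Qed.

Lemma lie_diag2 X Y X' Y' :
  lie (diag2 X Y : gl K 4) (diag2 X' Y') = diag2 (mx_lie X X') (mx_lie Y Y').
Proof.
rewrite /= /mx_lie /diag2 -[4%N]/(2 + 2)%N !mulmx_block.
by rewrite !mulmx0 !mul0mx !addr0 !add0r opp_block_mx add_block_mx !subr0.
Qed.

Lemma diag2_unit A B :
  \det A = 1 -> \det B = 1 -> diag2 A B \in unitmx.
Proof.
by move=> dA dB; rewrite unitmxE /diag2 (det_ublock A 0 B) dA dB mulr1 unitr1.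
Qed.

Lemma inner_aut_diag2 A B X Y : \det A = 1 -> \det B = 1 ->
  inner_aut (diag2 A B) (diag2 X Y) = diag2 (conj_mx A X) (conj_mx B Y).
Proof.
move=> dA dB; have uAB := diag2_unit dA dB; rewrite inner_autE.
(* Multiplying on the right by [diag2 A B] removes the inverse of a block matrix. *)
apply: (can_inj (mulmxK uAB)); rewrite mulmxKV //.
rewrite /diag2 -[4%N]/(2 + 2)%N !mulmx_block.
rewrite !mulmx0 !mul0mx !addr0 !add0r /conj_mx !mulmxKV //.
  by rewrite unitmxE dB unitr1.
by rewrite unitmxE dA unitr1.
Qed.

Lemma inner_aut_ker (A : 'M[K]_4) :
  A \in unitmx -> lker (inner_aut A) = 0%VS.
Proof.
move=> uA; by apply/eqP/lker0P => X Y; rewrite !inner_autE; apply: conj_mx_inj.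
Qed.

(** * The model embedding of [L2] and its image *)

Local Notation "u ^[ i ]" := (u 0 (inord i.-1)) (at level 2, format "u ^[ i ]").

Definition L2_vec (a b c : K) : 'rV[K]_3 :=
  a *: z K 1 + b *: z K 2 + c *: z K 3.

Lemma L2_vec_coord a b c :
  ((L2_vec a b c)^[1] = a) * ((L2_vec a b c)^[2] = b) * ((L2_vec a b c)^[3] = c).
Proof.
by do !split; rewrite !mxE -!val_eqE /= !inordK //=; ring.
Qed.

Lemma L2_vec_eta (u : 'rV[K]_3) : u = L2_vec u^[1] u^[2] u^[3].
Proof.
apply/rowP => j.
have -> : j = inord j.+1.-1 by apply/val_inj; rewrite /= inordK.
by case: j => [[|[|[|//]]] ?]; rewrite L2_vec_coord.
Qed.

(** Sends [z 1], [z 2], [z 3] to [x1], [x2], [(h1 + h2) / 2]; the half compensates for [[h, x] = 2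
    x]. *)
Definition L2_map (u : 'rV[K]_3) : 'M[K]_4 :=
  diag2 (borel (2^-1 * u^[3]) u^[1]) (borel (2^-1 * u^[3]) u^[2]).

Lemma L2_map_is_linear : linear L2_map.
Proof.
move=> k u v; rewrite /L2_map -diag2_linear -!borel_linear !mxE.
by congr (diag2 (borel _ _) (borel _ _)); ring.
Qed.

HB.instance Definition _ :=
  GRing.isLinear.Build K 'rV[K]_3 'M[K]_4 *:%R L2_map L2_map_is_linear.

Definition L2_hom : 'Hom(L2 K, gl K 4) := linfun L2_map.

Lemma memv_L2_hom c s t :
  2 != 0 :> K -> diag2 (borel c s) (borel c t) \in limg L2_hom.
Proof.
move=> two_neq0; apply/memv_imgP.
exists (L2_vec s t (2 * c)); first exact: memvf.
rewrite lfunE /= /L2_map !L2_vec_coord.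
by congr (diag2 (borel _ _) (borel _ _)); field.
Qed.

Hypothesis two_neq0 : 2 != 0 :> K.

Lemma L2_hom_embedding : lie_embedding L2_hom.
Proof.
split=> [|u v].
  apply/eqP/lker0P => u v; rewrite !lfunE /= => /diag2_inj[].
  move=> /mx2_inj[/(mulfI (invr_neq0 two_neq0)) e3 e1 _ _] /mx2_inj[_ e2 _ _].
  by rewrite [u]L2_vec_eta [v]L2_vec_eta e1 e2 e3.
have -> : lie u v = L2_vec (u^[3] * v^[1] - u^[1] * v^[3])
                           (u^[3] * v^[2] - u^[2] * v^[3]) 0.
  by rewrite /L2_vec scale0r addr0.
rewrite !lfunE lie_diag2 !lie_borel /= /L2_map !L2_vec_coord.
by congr (diag2 (borel _ _) (borel _ _)); field.
Qed.

Lemma L2_hom_so4 : (limg L2_hom <= so4 K)%VS.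
Proof.
apply/subvP => _ /memv_imgP[u _ ->]; rewrite lfunE; apply/so4P.
by do 2!eexists; split; last reflexivity; rewrite tr_mx2 subrr.
Qed.

Lemma E_ul (i j : 'I_2) : E K i.+1 j.+1 = diag2 (delta_mx i j) 0.
Proof.
have ulE (k : 'I_2) : inord k = lshift 2 k :> 'I_4.
  by apply/val_inj; rewrite /= inordK //; case: k => [[|[|]]].
rewrite /E /= !ulE -[4%N]/(2 + 2)%N delta_mx_ushift delta_mx_lshift.
by rewrite /diag2 /block_mx row_mx0.
Qed.

(** The shift by 3 is the block offset 2 plus 1 for the 1-based indices of [E]. *)
Lemma E_dr (i j : 'I_2) : E K i.+3 j.+3 = diag2 0 (delta_mx i j).
Proof.
have drE (k : 'I_2) : inord k.+2 = rshift 2 k :> 'I_4.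
  by apply/val_inj; rewrite /= inordK //; case: k => [[|[|]]].
rewrite /E /= !drE -[4%N]/(2 + 2)%N delta_mx_dshift delta_mx_rshift.
by rewrite /diag2 /block_mx row_mx0.
Qed.

Lemma limg_L2_hom :
  limg L2_hom = <<[:: x1 K; x2 K; (h1 K + h2 K)%R]>>%VS.
Proof.
have borelE (c t : K) :
    borel c t = c *: (delta_mx 0 0 - delta_mx 1 1) + t *: delta_mx 0 1.
  by rewrite [RHS]mx2_eta !mxE /=; congr mx2; ring.
have z1E : L2_hom (z K 1) = x1 K.
  have -> : z K 1 = L2_vec 1 0 0 by rewrite /L2_vec scale1r !scale0r !addr0.
  rewrite lfunE /= /L2_map !L2_vec_coord !borelE /x1 (E_ul 0 1).
  by rewrite mulr0 !scale0r !add0r scale1r.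
have z2E : L2_hom (z K 2) = x2 K.
  have -> : z K 2 = L2_vec 0 1 0 by rewrite /L2_vec scale1r !scale0r addr0 add0r.
  rewrite lfunE /= /L2_map !L2_vec_coord !borelE /x2 (E_dr 0 1).
  by rewrite mulr0 !scale0r !add0r scale1r.
have z3E : L2_hom (z K 3) = 2^-1 *: (h1 K + h2 K).
  have -> : z K 3 = L2_vec 0 0 1 by rewrite /L2_vec scale1r !scale0r !add0r.
  rewrite lfunE /= /L2_map !L2_vec_coord !borelE /h1 /h2.
  rewrite (E_ul 0 0) (E_ul 1 1) (E_dr 0 0) (E_dr 1 1) mulr1 scale0r addr0.
  rewrite /diag2 -[4%N]/(2 + 2)%N !opp_block_mx !add_block_mx scale_block_mx.
  by rewrite !oppr0 !addr0 !add0r !scaler0.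
rewrite -(span_basis (L2_basis K)) limg_span /= z1E z2E z3E !span_cons.
congr (_ + (_ + (_ + _)))%VS.
(* [h1 + h2] and its half span the same line. *)
apply/eqP; rewrite eqEsubv; apply/andP; split; apply/subvP => _ /vlineP[k ->].
  by rewrite scalerA memvZ ?memv_line.
apply/vlineP; exists (k * 2); rewrite scalerA; congr (_ *: _); by field.
Qed.

(** * Uniqueness up to inner automorphism *)

Lemma L2_so4_inner_equiv (e : 'Hom(L2 K, gl K 4)) :
  lie_embedding e -> (limg e <= so4 K)%VS -> inner_equiv (limg e) (limg L2_hom).
Proof.
move=> [e_inj e_lie] /subvP e_so4.
have zP i : exists X Y, [/\ \tr X = 0, \tr Y = 0 & e (z K i) = diag2 X Y].
  by apply/so4P/e_so4; rewrite memv_img ?memvf.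
have [a1 [a2 [_ _ ea]]] := zP 1%N.
have [b1 [b2 [_ _ eb]]] := zP 2%N.
have [c1 [c2 [trc1 trc2 ec]]] := zP 3%N.
have := e_lie (z K 3) (z K 1); have := e_lie (z K 3) (z K 2).
rewrite L2_z3z1 L2_z3z2 ea eb ec !lie_diag2.
move=> /diag2_inj[/esym eb1 /esym eb2] /diag2_inj[/esym ea1 /esym ea2].
(* A relation valid in both blocks puts [s z1 + t z2] in the kernel of [e], which is zero. *)
have indep s t :
    s *: a1 + t *: b1 = 0 -> s *: a2 + t *: b2 = 0 -> (s, t) = 0.
  move=> e1 e2; have st0 : s *: diag2 a1 a2 + t *: diag2 b1 b2 = 0.
    rewrite /diag2 -[4%N]/(2 + 2)%N !scale_block_mx add_block_mx e1 e2.
    by rewrite !scaler0 !addr0 block_mx0.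
  have : e (L2_vec s t 0) = e (L2_vec 0 0 0).
    by rewrite !linearD !linearZ /= ea eb !scale0r !addr0.
  move/(lker0P (introT eqP e_inj)) => st.
  rewrite -(L2_vec_coord s t 0).1.1 -{2}(L2_vec_coord s t 0).1.2 st.
  by rewrite !L2_vec_coord.
(* If the eigenvectors a1 and b1 of ad c1 both vanished, then a2 and b2, which
   lie on the eigenline of ad c2, would make e (z 1) and e (z 2) dependent. *)
have nz1 : exists2 N, N != 0 & mx_lie c1 N = N.
  have [a10|] := eqVneq a1 0; last by exists a1.
  have [b10|] := eqVneq b1 0; last by exists b1.
  have [s [t [st /eqP[]]]] := sl2_eigenvectors_dependent two_neq0 trc2 ea2 eb2.
  by apply: indep; rewrite // a10 b10 !scaler0 addr0.
have nz2 : exists2 N, N != 0 & mx_lie c2 N = N.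
  have [a20|] := eqVneq a2 0; last by exists a2.
  have [b20|] := eqVneq b2 0; last by exists b2.
  have [s [t [st /eqP[]]]] := sl2_eigenvectors_dependent two_neq0 trc1 ea1 eb1.
  by apply: indep; rewrite // a20 b20 !scaler0 addr0.
have [N1 N10 eN1] := nz1; have [N2 N20 eN2] := nz2.
have [A detA [[s1 cA] eigA]] := sl2_eigenvector_conj two_neq0 trc1 eN1 N10.
have [B detB [[s2 cB] eigB]] := sl2_eigenvector_conj two_neq0 trc2 eN2 N20.
exists A, B; split=> //; apply/eqP; rewrite -/(diag2 A B) eqEdim.
have kerAB := inner_aut_ker (diag2_unit detA detB).
(* All maps involved are injective, so both sides have the dimension of [L2] and one inclusion
   suffices. *)
rewrite !limg_dim_eq ?kerAB ?e_inj ?(proj1 L2_hom_embedding) ?capv0 //.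
rewrite leqnn andbT.
apply/subvP => _ /memv_imgP[_ /memv_imgP[u _ ->] ->].
(* Both blocks of the image of [z 3] get the same diagonal coefficient [2^-1], as membership in the
   model requires. *)
rewrite [u]L2_vec_eta !linearD !linearZ /= ea eb ec !inner_aut_diag2 // cA cB.
have [[ta1 ->] [ta2 ->]] := (eigA _ ea1, eigB _ ea2).
have [[tb1 ->] [tb2 ->]] := (eigA _ eb1, eigB _ eb2).
by rewrite !memvD // memvZ // memv_L2_hom.
Qed.

End So4.

Theorem theorem5p5 (R : realType) :
  exists L21 : lieSubalg (gl R[i] 4),
    [/\ lsub_space L21 = <<[:: x1 R[i]; x2 R[i]; (h1 R[i] + h2 R[i])%R]>>%VS,
        (L21 <= so4 R[i])%VS,
        lie_isomorphic (subLieAlg L21) (L2 R[i])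
      & forall S : lieSubalg (gl R[i] 4),
          (S <= so4 R[i])%VS -> lie_isomorphic (subLieAlg S) (L2 R[i]) ->
          inner_equiv S L21].
Proof.
have two_neq0 : 2 != 0 :> R[i] by rewrite pnatr_eq0.
have emb := L2_hom_embedding two_neq0.
(* Taking the image of the model embedding as witness yields closure and the isomorphism at once. *)
exists (LieSubalg (limg_lie_closed emb)); split.
- exact: limg_L2_hom.
- exact: L2_hom_so4.
- by apply/lie_isomorphic_embedding; exists (L2_hom R[i]).
move=> S S_so4 /lie_isomorphic_embedding[e e_emb eS] /=; rewrite -eS.
by apply: L2_so4_inner_equiv; rewrite ?eS.
Qed.
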